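(* Let $n\ge 1$ be an integer, let $0\le\alpha<1$, and let $f=h+\overline{g}\in\mathscr{P}_{\mathcal{H}_n^0}(\alpha)$ have the expansion $$h(z)=\sum_{j=1}^n z_j+\sum_{k=2}^\infty\sum_{|\beta|=k}a_\beta z^\beta,\qquad g(z)=\sum_{k=2}^\infty\sum_{|\beta|=k}b_\beta z^\beta .$$ Then for each integer $q\ge 2$, $S_{1,q}(f)\in\mathscr{P}_{\mathcal{H}_n^0}(\alpha)$ for $\|z\|_\infty<\frac{1}{2n^2}$; that is, $S_{1,q}(f)=S_1(h)+\overline{S_q(g)}$ satisfies $$\sum_{k=1}^n\Re\left(\frac{\partial S_1(h)(z)}{\partial z_k}-\alpha\right)>\sum_{k=1}^n\left|\frac{\partial S_q(g)(z)}{\partial z_k}\right|\qquad\text{for all } z\in\mathbb{C}^n\text{ with }\|z\|_\infty<\frac{1}{2n^2}.$$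
   Context: $\mathbb{P}\Delta(0;1)=\{z\in\mathbb{C}^n:|z_j|<1,\ j=1,\dots,n\}$ is the unit polydisc, and $\|z\|_\infty=\max_{1\le j\le n}|z_j|$. For a multi-index $\beta=(\beta_1,\dots,\beta_n)\in\mathbb{N}_0^n$, $|\beta|=\sum_j\beta_j$ and $z^\beta=\prod_j z_j^{\beta_j}$; $\sum_{|\beta|=m}$ runs over all multi-indices of order $m$. A complex-valued pluriharmonic mapping on $\mathbb{P}\Delta(0;1)$ is a function of the form $f=h+\overline{g}$ with $h,g$ holomorphic on $\mathbb{P}\Delta(0;1)$. $\mathcal{H}_n^0$ denotes the class of pluriharmonic mappings $f=h+\overline{g}$ on $\mathbb{P}\Delta(0;1)$ with $f(0)=0$, $\frac{\partial f}{\partial z_j}(0)=1$ and $\frac{\partial f}{\partial\overline{z_j}}(0)=0$ for $j=1,\dots,n$; equivalently, $h$ and $g$ (normalized by $h(0)=g(0)=0$) have power series $$h(z)=\sum_{j=1}^n z_j+\sum_{k=2}^\infty\sum_{|\beta|=k}a_\beta z^\beta,\qquad g(z)=\sum_{k=2}^\infty\sum_{|\beta|=k}b_\beta z^\beta .$$ For $0\le\alpha<1$, $\mathscr{P}_{\mathcal{H}_n^0}(\alpha)$ is the class of all $f=h+\overline{g}\in\mathcal{H}_n^0$ such that for all $z\in\mathbb{P}\Delta(0;1)$, $$\sum_{k=1}^n\Re\left(\frac{\partial h(z)}{\partial z_k}-\alpha\right)>\sum_{k=1}^n\left|\frac{\partial g(z)}{\partial z_k}\right|.$$ Sections (partial sums):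 $S_1(h)(z)=\sum_{j=1}^n z_j$, $S_q(g)(z)=\sum_{m=2}^q\sum_{|\beta|=m}b_\beta z^\beta$ for $q\ge2$, and $S_{1,q}(f)=S_1(h)+\overline{S_q(g)}$. *)

(* Defs.v *)
From HB Require Import structures.
From mathcomp Require Import all_boot all_order all_algebra.
From mathcomp Require Import complex.
From mathcomp Require Import all_classical all_reals all_analysis.

Set Implicit Arguments.
Unset Strict Implicit.
Unset Printing Implicit Defensive.

Import Order.TTheory GRing.Theory Num.Theory.
Import numFieldNormedType.Exports.

Local Open Scope classical_set_scope.
Local Open Scope ring_scope.

(* R[i] itself carries no canonical topology; packing it as an abstract
   numClosedFieldType gives it, and ['rV_n] over it, the normed-space
   structures (over the complex scalars) declared for any numFieldType.
   The norm of a row vector is the maximum of the moduli of its entries. *)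
Definition Cplx (R : realType) : numClosedFieldType := R[i].

Definition toC (R : realType) (x : R) : Cplx R := x%:C%C.

Section Pluriharmonic.
Variables (R : realType) (n : nat).
Local Notation C := (Cplx R).
Local Notation Cn := 'rV[C]_n.
Implicit Types (f h g : Cn -> C) (z : Cn).

Definition polydisc : set Cn := [set z | forall j, `|z 0 j| < 1].

Definition basis_vec (j : 'I_n) : Cn := delta_mx 0 j.

Definition holomorphic h := forall z, polydisc z -> differentiable h z.

(* 'D_v is a limit over complex increments. *)
Definition partial h (j : 'I_n) z : C := 'D_(basis_vec j) h z.

(* Directional derivative with real increments. *)
Definition real_deriv f (v z : Cn) : C :=
  lim ((toC t)^-1 * (f (z + toC t *: v) - f z) @[t --> (0 : R)^']).

(* d/dz_j = (d/dx_j - i d/dy_j) / 2 and d/d\bar{z_j} = (d/dx_j + i d/dy_j) / 2,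
   where z_j = x_j + i y_j. *)
Definition wirtinger f (j : 'I_n) z : C :=
  2^-1 * (real_deriv f (basis_vec j) z
          - 'i * real_deriv f ('i *: basis_vec j) z).

Definition wirtinger_bar f (j : 'I_n) z : C :=
  2^-1 * (real_deriv f (basis_vec j) z
          + 'i * real_deriv f ('i *: basis_vec j) z).

Definition pluriharmonic_decomp f h g :=
  [/\ holomorphic h, holomorphic g
    & forall z, polydisc z -> f z = h z + (g z)^*].

Definition pluriharmonic f := exists h g, pluriharmonic_decomp f h g.

Definition class_H0 f :=
  [/\ pluriharmonic f, f 0 = 0,
      forall j, wirtinger f j 0 = 1
    & forall j, wirtinger_bar f j 0 = 0].

(* h and g are determined by f up to additive constants, so the inequality
   does not depend on the decomposition. *)
Definition class_P (alpha : R) f :=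
  class_H0 f /\
  exists h g, pluriharmonic_decomp f h g /\
    forall z, polydisc z ->
      \sum_(k < n) 'Re (partial h k z - toC alpha)
        > \sum_(k < n) `|partial g k z|.

Definition multi_index := {ffun 'I_n -> nat}.

Definition monomial (beta : multi_index) z : C := \prod_(j < n) z 0 j ^+ beta j.

(* \sum_(|beta| = m) c_beta z^beta; the entries of a multi-index of order m
   are at most m. *)
Definition homog_part (c : multi_index -> C) (m : nat) z : C :=
  \sum_(b : {ffun 'I_n -> 'I_m.+1} | (\sum_(j < n) b j)%N == m)
    let beta : multi_index := [ffun j => nat_of_ord (b j)] in
    c beta * monomial beta z.

Definition linear_section z : C := \sum_(j < n) z 0 j.

Definition higher_section (c : multi_index -> C) (q : nat) z : C :=
  \sum_(2 <= m < q.+1) homog_part c m z.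

End Pluriharmonic.

(* Main.v *)
Require Import Defs.
From HB Require Import structures.
From mathcomp Require Import all_boot all_order all_algebra.
From mathcomp Require Import cyclic separable cyclotomic ring.
From mathcomp Require Import complex.
From mathcomp Require Import all_classical all_reals all_analysis.
Set Implicit Arguments.
Unset Strict Implicit.
Unset Printing Implicit Defensive.
Import Order.TTheory GRing.Theory Num.Theory.
Import numFieldNormedType.Exports.
Local Open Scope classical_set_scope.
Local Open Scope ring_scope.

(** Let g_m be the part of g of degree m, and let w be a point of the polydisc.
    On the circle |x| = 1 the functions d_k g (x w) have the Taylor coefficients
    d_k g_(m+1) (w), and Re (sum_k d_k h (x w)) has mean value n.  Averaging the
    inequality that defines the class over the circle therefore gives
    sum_k |d_k g_(m+1) (w)| <= n (1 - alpha) for every m.  For |z| < 1/2 take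
    w = 2 z: by homogeneity sum_k |d_k g_(m+1) (z)| <= 2^-m n (1 - alpha), and
    sum_(1 <= m < q) 2^-m < 1.

    Integrals over the circle are replaced by means over the N-th roots of unity
    with N tending to infinity.  Termwise differentiation of the homogeneous
    expansion rests on the Cauchy estimates for the polynomials t |-> g_m (w + t v),
    which follow from the boundedness of g on closed polydiscs, by compactness. *)

(** * Roots of unity and geometric tails *)

(** In characteristic 0 the polynomial ['X^N - 1] is separable, so it has [N] distinct roots, and
    [N] distinct N-th roots of unity must include a primitive one. *)
Lemma closed_prim_root_exists (C : numClosedFieldType) (N : nat) :
  (0 < N)%N -> exists w : C, N.-primitive_root w.
Proof.
move=> N_gt0; pose p : {poly C} := 'X^N - 1.
have [r Dp] := closed_field_poly_normal p.
rewrite (monicP _) ?monicXnsubC // scale1r in Dp.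
have rn1 : all N.-unity_root r by apply/allP=> z; rewrite -root_prod_XsubC -Dp.
have sz_r : (N < (size r).+1)%N.
  by rewrite -(size_prod_XsubC r id) -Dp size_XnsubC.
have [|z] := hasP (has_prim_root N_gt0 rn1 _ sz_r); last by exists z.
by rewrite -separable_prod_XsubC -Dp separable_Xn_sub_1 // pnatr_eq0 -lt0n.
Qed.

Lemma prim_root_norm (C : numClosedFieldType) (N : nat) (w : C) :
  N.-primitive_root w -> `|w| = 1.
Proof.
move=> w_prim; apply/eqP.
rewrite -(pexpr_eq1 (prim_order_gt0 w_prim)) ?normr_ge0 // -normrX.
by rewrite prim_expr_order // normr1.
Qed.

(** This is a geometric sum with ratio [x = w ^ (l - m)]. Either [x = 1], or [(x - 1)] times the sum
    is [x ^+ N - 1 = 0]. *)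
Lemma prim_root_orthogonality (C : numClosedFieldType) (N : nat) (w : C) (m l : nat) :
  N.-primitive_root w ->
  \sum_(j < N) (w ^+ j) ^- m * (w ^+ j) ^+ l =
    if l == m %[mod N] then N%:R else 0.
Proof.
move=> w_prim; have w_neq0 : w != 0.
  by rewrite -normr_eq0 (prim_root_norm w_prim) oner_eq0.
pose x := w ^- m * w ^+ l.
have -> : \sum_(j < N) (w ^+ j) ^- m * (w ^+ j) ^+ l = \sum_(j < N) x ^+ j.
  apply: eq_bigr => j _.
  by rewrite exprMn exprVn -!exprM ![(_ * j)%N]mulnC.
have x_eq1 : (x == 1) = (l == m %[mod N]).
  rewrite -(eq_prim_root_expr w_prim) /x mulrC -subr_eq0.
  by rewrite -[X in _ - X](divff (expf_neq0 m w_neq0)) -mulrBl mulf_eq0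
     invr_eq0 expf_eq0 (negPf w_neq0) andbF orbF subr_eq0.
case: ifP => [lm|nlm].
  rewrite -x_eq1 in lm; rewrite (eqP lm).
  rewrite (eq_bigr (fun=> 1)) ?sumr_const ?card_ord // => j _.
  by rewrite expr1n.
have xN : x ^+ N = 1.
  rewrite exprMn exprVn -!exprM ![(_ * N)%N]mulnC !exprM.
  by rewrite (prim_expr_order w_prim) !expr1n invr1 mulr1.
have := subrX1 x N; rewrite xN subrr => /esym/eqP.
by rewrite mulf_eq0 subr_eq0 x_eq1 nlm /= => /eqP.
Qed.

Lemma geometric_tail_le (K : numFieldType) (s : K) (N L : nat) :
  0 <= s < 1 -> \sum_(N <= l < L) s ^+ l <= s ^+ N / (1 - s).
Proof.
move=> /andP[s_ge0 s_lt1]; have s1 : 0 < 1 - s by rewrite subr_gt0.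
have [LN|/ltnW NL] := leqP L N.
  by rewrite big_geq // divr_ge0 ?exprn_ge0 // ltW.
rewrite ler_pdivlMr // mulr_suml.
rewrite (eq_bigr (fun l => - (s ^+ l.+1 - s ^+ l))); last first.
  by move=> l _; rewrite mulrBr mulr1 exprSr opprB.
by rewrite sumrN telescope_sumr // opprB lerBlDr lerDl exprn_ge0.
Qed.

(** * Discrete means over the unit circle *)

Section CircleMean.
Variables (C : numClosedFieldType) (N : nat) (w : C).
Hypothesis w_prim : N.-primitive_root w.

(* A discrete stand-in for the m-th Fourier coefficient of u on the unit
   circle; on power series it only aliases coefficients congruent mod N. *)
Definition circle_mean (m : nat) (u : C -> C) : C :=
  N%:R^-1 * \sum_(j < N) (w ^+ j) ^- m * u (w ^+ j).

Let N_neq0 : N%:R != 0 :> C.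
Proof. by rewrite pnatr_eq0 -lt0n (prim_order_gt0 w_prim). Qed.

Lemma circle_mean_poly (c : nat -> C) (m L : nat) :
  circle_mean m (fun x => \sum_(l < L) c l * x ^+ l) =
  \sum_(l < L | l == m %[mod N]) c l.
Proof.
rewrite /circle_mean.
under eq_bigr do rewrite mulr_sumr.
rewrite exchange_big /= mulr_sumr [RHS]big_mkcond /=.
apply: eq_bigr => l _.
under eq_bigr do rewrite mulrCA.
rewrite -mulr_sumr (prim_root_orthogonality _ _ w_prim).
by case: ifP => _; rewrite ?mulr0 // mulrCA mulVf // mulr1.
Qed.

Lemma circle_mean_tail (c : nat -> C) (m L : nat) (K s : C) :
  0 <= K -> 0 <= s < 1 -> (forall l, `|c l| <= K * s ^+ l) ->
  (m < N)%N -> (m < L)%N ->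
  `|circle_mean m (fun x => \sum_(l < L) c l * x ^+ l) - c m|
     <= K * (s ^+ N / (1 - s)).
Proof.
move=> K_ge0 s01 c_le mN mL; have /andP[s_ge0 s_lt1] := s01.
rewrite circle_mean_poly (bigD1 (Ordinal mL)) //= addrC addrK.
apply: (le_trans (ler_norm_sum _ _ _)).
apply: (@le_trans _ _ (\sum_(l < L | (N <= l)%N) K * s ^+ l)).
  rewrite [leLHS]big_mkcond [leRHS]big_mkcond /=; apply: ler_sum => l _.
  case: ifP => [/andP[/eqP lm l_neq]|_]; last first.
    by case: ifP => _; rewrite ?mulr_ge0 ?exprn_ge0.
  have -> : (N <= l)%N; last exact: c_le.
  rewrite leqNgt; apply: contra l_neq => lN.
  by rewrite -val_eqE /= -(modn_small lN) lm modn_small.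
rewrite -mulr_sumr ler_wpM2l //.
apply: le_trans (geometric_tail_le N L s01).
by rewrite (@big_nat_widenl _ _ _ N 0) // big_mkord.
Qed.

Lemma circle_mean_norm (m : nat) (u : C -> C) :
  `|circle_mean m u| <= N%:R^-1 * \sum_(j < N) `|u (w ^+ j)|.
Proof.
rewrite normrM normfV normr_nat ler_wpM2l ?invr_ge0 ?ler0n //.
apply: (le_trans (ler_norm_sum _ _ _)); apply: ler_sum => j _.
by rewrite normrM normfV !normrX (prim_root_norm w_prim) !expr1n invr1 mul1r.
Qed.

End CircleMean.

(** * Limits, and coefficient estimates from values on a circle *)

Lemma cvg_norm_le (K : numFieldType) (T : Type) (F : set_system T)
    (FF : ProperFilter F) (f : T -> K) (l B : K) :
  f x @[x --> F] --> l -> (\forall x \near F, `|f x| <= B) -> `|l| <= B.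
Proof.
move=> fl fB; have /filter_ex[x0 fx0] := fB.
have B_real : B \is Num.real by rewrite ger0_real // (le_trans _ fx0).
rewrite real_leNgt ?normr_real //; apply/negP => Bl.
have /filter_ex[x [/= fxB Bfx]] : \forall x \near F, `|f x| <= B /\ B < `|f x|.
  by apply: filterI => //; exact: cvgr_norm_gt fl _ Bl.
by have := lt_le_trans Bfx fxB; rewrite ltxx.
Qed.

Lemma cvg_horner (K : numFieldType) (T : Type) (F : set_system T) (FF : Filter F)
    (f : T -> K) (p : {poly K}) (x : K) :
  f t @[t --> F] --> x -> p.[f t] @[t --> F] --> p.[x].
Proof.
move=> fx; elim/poly_ind: p => [|p c ih].
  rewrite (_ : (fun t => _) = cst 0); last by apply/funext => y; rewrite horner0.
  by rewrite horner0; exact: cvg_cst.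
rewrite (_ : (fun t => _) = fun y => p.[f y] * f y + c); last first.
  by apply/funext => y; rewrite hornerMXaddC.
by rewrite hornerMXaddC; apply: cvgD; [exact: cvgM | exact: cvg_cst].
Qed.

(* The complex numbers enter only through two properties, kept as section
   hypotheses: powers of s in [0, 1) tend to 0, and closed discs are compact. *)
Section AbstractComplex.
Variable C : numClosedFieldType.
Hypothesis cvg_exprC : forall s : C, 0 <= s < 1 -> s ^+ N @[N --> \oo] --> 0.

(** The order of [C] is partial, so [x] and [y] are assumed real to be comparable; if [y < x], the
    error [K * s ^+ N] could not drop below [x - y]. *)
Lemma le_of_geometric (m : nat) (x y K s : C) : x \is Num.real -> y \is Num.real ->
  0 <= s < 1 -> (forall N, (m < N)%N -> x <= y + K * s ^+ N) -> x <= y.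
Proof.
move=> x_real y_real s01 H; rewrite real_leNgt //; apply/negP => yx.
have r_cvg : K * s ^+ N @[N --> \oo] --> 0.
  by rewrite -(mulr0 K); apply: cvgMr; exact: cvg_exprC.
have yx0 : `|0 : C| < x - y by rewrite normr0 subr_gt0.
have /filter_ex[N [/= mN]] :
    \forall N \near \oo, (m < N)%N /\ `|K * s ^+ N| < x - y.
  by apply: filterI; [exact: nbhs_infty_gt | exact: cvgr_norm_lt r_cvg _ yx0].
have := H N mN; rewrite -lerBlDl => le_xy.
(* [K] is not assumed real: the sign of the error term comes from the inequality itself. *)
have ks_gt0 : 0 < K * s ^+ N by apply: lt_le_trans le_xy; rewrite subr_gt0.
by rewrite gtr0_norm // => /(le_lt_trans le_xy); rewrite ltxx.
Qed.

(* Average the inequality over the N-th roots of unity and let N tend to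
   infinity. *)
Lemma sum_coef_le_Re (n : nat) (c : 'I_n -> nat -> C) (u : 'I_n -> C -> C)
    (d : nat -> C) (v : C -> C) (A K s : C) :
  A \is Num.real -> 0 <= K -> 0 <= s < 1 ->
  (forall k l, `|c k l| <= K * s ^+ l) -> (forall l, `|d l| <= K * s ^+ l) ->
  (forall x k, `|x| = 1 -> \sum_(l < L) c k l * x ^+ l @[L --> \oo] --> u k x) ->
  (forall x, `|x| = 1 -> \sum_(l < L) d l * x ^+ l @[L --> \oo] --> v x) ->
  (forall x, `|x| = 1 -> \sum_(k < n) `|u k x| <= 'Re (v x) - A) ->
  forall m, \sum_(k < n) `|c k m| <= 'Re (d 0) - A.
Proof.
move=> A_real K_ge0 s01 c_le d_le c_cvg d_cvg uv m.
have /andP[s_ge0 s_lt1] := s01.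
(* For fixed [N] the mean is a finite sum, so the aliasing bound for partial sums, being uniform in
   [L], passes to the limit function. *)
have mean_cvg (N : nat) w e (y : C -> C) i : N.-primitive_root w -> (i < N)%N ->
    (forall l, `|e l| <= K * s ^+ l) ->
    (forall x, `|x| = 1 -> \sum_(l < L) e l * x ^+ l @[L --> \oo] --> y x) ->
    `|circle_mean N w i y - e i| <= K * (s ^+ N / (1 - s)).
  move=> w_prim iN e_le e_cvg.
  apply: (@cvg_norm_le C nat \oo _
    (fun L => circle_mean N w i (fun x => \sum_(l < L) e l * x ^+ l) - e i)).
    apply: cvgB; last exact: cvg_cst.
    apply: cvgMr; apply: cvg_big => [|j _]; [exact: add_continuous|apply: cvgMr]; apply: e_cvg.
    by rewrite normrX (prim_root_norm w_prim) expr1n.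
  near=> L; apply: circle_mean_tail => //; near: L; exact: nbhs_infty_gt.
(* There are [n + 1] aliasing errors: one for each [u k] and one for [v]. *)
apply: (@le_of_geometric m _ _ (n.+1%:R * (K / (1 - s))) s) => //.
- by apply: rpred_sum => k _; exact: normr_real.
- by rewrite rpredB // Creal_Re.
move=> N mN; have N_gt0 : (0 < N)%N by exact: leq_ltn_trans mN.
have [w w_prim] := closed_prim_root_exists C N_gt0.
set E := K * (s ^+ N / (1 - s)).
have -> : n.+1%:R * (K / (1 - s)) * s ^+ N = E *+ n.+1.
  by rewrite -mulrA -[RHS]mulr_natl /E; congr (_ * _); rewrite mulrAC mulrA.
have le1 : \sum_(k < n) `|c k m| <= \sum_(k < n) `|circle_mean N w m (u k)| + E *+ n.
  rewrite -[n in E *+ n]card_ord -sumr_const -big_split /=; apply: ler_sum => k _.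
  rewrite -lerBlDl; apply: le_trans (lerB_dist _ _) _.
  by rewrite distrC; apply: mean_cvg => // x /c_cvg.
have le2 : \sum_(k < n) `|circle_mean N w m (u k)| <= 'Re (circle_mean N w 0 v) - A.
  apply: (@le_trans _ _ (N%:R^-1 * \sum_(j < N) ('Re (v (w ^+ j)) - A))).
    apply: (@le_trans _ _ (\sum_(k < n) N%:R^-1 * \sum_(j < N) `|u k (w ^+ j)|)).
      by apply: ler_sum => k _; exact: circle_mean_norm.
    rewrite -mulr_sumr exchange_big /= ler_wpM2l ?invr_ge0 ?ler0n //.
    apply: ler_sum => j _; apply: uv.
    by rewrite normrX (prim_root_norm w_prim) expr1n.
  rewrite sumrB sumr_const card_ord mulrBr -[A *+ N]mulr_natl mulKf ?pnatr_eq0 -?lt0n //.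
  rewrite lerD2r /circle_mean.
  under [in leRHS]eq_bigr do rewrite expr0 invr1 mul1r.
  by rewrite -(raddf_sum (@Re _)) ReMl ?rpredV ?rpred_nat.
have le3 : 'Re (circle_mean N w 0 v) <= 'Re (d 0%N) + E.
  rewrite -lerBlDl -raddfB /=.
  apply: le_trans (mean_cvg N w d v 0%N w_prim N_gt0 d_le d_cvg).
  exact: (leif_Re_Creal _).1.
apply: le_trans le1 _; rewrite mulrS addrA lerD2r.
by rewrite (le_trans le2) // addrAC lerD2r.
Unshelve. all: by end_near. Qed.

(** The case [n = 1], [A = 0] of the averaging lemma, with the constant [M] as dominating function;
    its expansion [d] is [M] followed by zeros. *)
Lemma coef_le_sup (c : nat -> C) (u : C -> C) (M K s : C) :
  0 <= K -> 0 <= s < 1 -> (forall l, `|c l| <= K * s ^+ l) ->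
  (forall x, `|x| = 1 -> \sum_(l < L) c l * x ^+ l @[L --> \oo] --> u x) ->
  (forall x, `|x| = 1 -> `|u x| <= M) ->
  forall m, `|c m| <= M.
Proof.
move=> K_ge0 /[dup] s01 /andP[s_ge0 _] c_le c_cvg u_le m.
have M_ge0 : 0 <= M by apply: le_trans (u_le 1 _); rewrite ?normr1.
pose d l : C := if l == 0%N then M else 0.
have := @sum_coef_le_Re 1 (fun=> c) (fun=> u) d (fun=> M) 0 (K + M) s _ _ s01.
rewrite rpred0 => /(_ isT); rewrite addr_ge0 // => /(_ isT) H.
suff : \sum_(k < 1) `|c m| <= 'Re (d 0%N) - 0.
  by rewrite big_ord1 subr0 (Creal_ReP _ (ger0_real M_ge0)).
apply: H => [_ l|l|x _ /c_cvg//|x _|x /u_le].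
- by apply: le_trans (c_le l) _; rewrite ler_wpM2r ?exprn_ge0 // lerDl.
- rewrite /d; case: eqP => [->|_]; last by rewrite normr0 mulr_ge0 ?exprn_ge0 ?addr_ge0.
  by rewrite expr0 mulr1 ger0_norm // lerDr.
- rewrite -cvg_shiftS /= (_ : (fun _ => _) = cst M); first exact: cvg_cst.
  apply/funext => L /=; rewrite big_ord_recl expr0 mulr1 big1 ?addr0 // => i _.
  by rewrite /d mul0r.
- by rewrite big_ord1 subr0 (Creal_ReP _ (ger0_real M_ge0)).
Qed.

(** Cauchy's estimate, by rescaling to the unit circle. Only finitely many coefficients are nonzero,
    so any rate of decay can be claimed; [2^-1] is an arbitrary choice. *)
Lemma poly_coef_le_sup (p : {poly C}) (r M : C) : 0 < r ->
  (forall t, `|t| = r -> `|p.[t]| <= M) -> forall i, `|p`_i| * r ^+ i <= M.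
Proof.
move=> r_gt0 p_le i; have r_ge0 := ltW r_gt0.
rewrite -[in leLHS](ger0_norm r_ge0) -normrX -normrM.
pose c j := p`_j * r ^+ j; rewrite -/(c i).
have half01 : 0 <= (2^-1 : C) < 1.
  by rewrite invr_ge0 ler0n invf_lt1 ?ltr0n ?ltr1n.
apply: (@coef_le_sup c (fun x => p.[r * x]) M
  (\sum_(j < size p) `|c j| * 2 ^+ j) 2^-1) => //.
- by apply: sumr_ge0 => j _; rewrite mulr_ge0 ?exprn_ge0.
- move=> l; rewrite exprVn ler_pdivlMr ?exprn_gt0 //.
  have [lp|pl] := ltnP l (size p); last first.
    rewrite /c nth_default // mul0r normr0 mul0r.
    by apply: sumr_ge0 => j _; rewrite mulr_ge0 ?exprn_ge0.
  rewrite (bigD1 (Ordinal lp)) //= lerDl.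
  by apply: sumr_ge0 => j _; rewrite mulr_ge0 ?exprn_ge0.
- move=> x _; apply: cvg_near_cst; near=> L.
  rewrite (@horner_coef_wide _ L); last by near: L; exact: nbhs_infty_ge.
  by apply: eq_bigr => j _; rewrite exprMn /c mulrA.
- by move=> x x1; apply: p_le; rewrite normrM x1 mulr1 ger0_norm.
Unshelve. all: by end_near. Qed.

(** With [x = |t| / r <= 1/2], Cauchy's estimate bounds the term of degree [i] by [M * x ^+ i], and
    the tail from degree 2 is at most [M * x ^+ 2 / (1 - x) <= 2 * M * x ^+ 2]. *)
Lemma poly_taylor1_le (p : {poly C}) (r M t : C) : 0 < r ->
  (forall x, `|x| = r -> `|p.[x]| <= M) -> `|t| <= r / 2 ->
  `|p.[t] - p`_0 - p`_1 * t| <= M * (2 / r ^+ 2) * `|t| ^+ 2.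
Proof.
move=> r_gt0 p_le tr; have r_ge0 := ltW r_gt0.
have r_neq0 := lt0r_neq0 r_gt0.
have M_ge0 : 0 <= M := le_trans (normr_ge0 _) (p_le r (ger0_norm r_ge0)).
pose x := `|t| / r.
have x_ge0 : 0 <= x by rewrite divr_ge0.
have x_le : x <= 2^-1 by rewrite /x ler_pdivrMr // mulrC.
have half_lt1 : (2^-1 : C) < 1 by rewrite invf_lt1 ?ltr0n ?ltr1n.
have x01 : 0 <= x < 1 by rewrite x_ge0 (le_lt_trans x_le).
(* Widening to [(size p).+2] terms lets the first two be split off even when [p] is constant. *)
rewrite (@horner_coef_wide _ (size p).+2) 1?ltnW //.
rewrite -(big_mkord xpredT (fun i => p`_i * t ^+ i)) big_ltn // big_ltn //.
rewrite expr0 mulr1 expr1; set S := \sum_(2 <= i < _) _.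
have -> : p`_0 + (p`_1 * t + S) - p`_0 - p`_1 * t = S by ring.
apply: (@le_trans _ _ (\sum_(2 <= i < (size p).+2) M * x ^+ i)).
  apply: le_trans (ler_norm_sum _ _ _) _; apply: ler_sum => i _.
  rewrite normrM normrX -[`|t|](divfK r_neq0) -/x exprMn mulrCA mulrC.
  by rewrite ler_wpM2r ?exprn_ge0 ?poly_coef_le_sup.
rewrite -mulr_sumr -mulrA ler_wpM2l //.
apply: le_trans (geometric_tail_le 2 _ x01) _.
rewrite [in leRHS]mulrAC -mulrA -expr_div_n -/x mulrC ler_wpM2r ?exprn_ge0 //.
rewrite invf_ple ?posrE ?subr_gt0 //; last by case/andP: x01.
by rewrite lerBrDl -lerBrDr; apply: le_trans x_le _; rewrite [leRHS](_ : _ = 2^-1) //; field.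
Qed.

Lemma derive_along_poly (n : nat) (G : 'rV[C]_n -> C) (w v : 'rV[C]_n) (p : {poly C}) :
  (forall t, G (w + t *: v) = p.[t]) -> 'D_v G w = p^`().[0].
Proof.
move=> Gp; rewrite horner_coef0 coef_deriv mulr1n /derive.
apply: cvg_lim => //.
(* [q] is the difference quotient of [p] at 0; being a polynomial, it is continuous there. *)
pose q := \poly_(i < size p) p`_i.+1.
have pq : p = (p`_0)%:P + 'X * q.
  apply/polyP => -[|i]; rewrite coefD coefC coefXM /= ?addr0 //.
  rewrite add0r coef_poly; case: ltnP => // pi; rewrite nth_default //.
  exact: leqW.
have q_cvg : q.[t] @[t --> 0^'] --> q.[0].
  by apply: cvg_horner; exact: cvg_within.
rewrite horner_coef0 coef_poly in q_cvg.
have -> : p`_1 = (if (0 < size p)%N then p`_1 else 0).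
  by case: ltnP => // p0; rewrite nth_default // (leq_trans p0).
apply: cvg_trans q_cvg; apply: near_eq_cvg; near=> t.
have t_neq0 : t != 0 by near: t; exact: nbhs_dnbhs_neq.
have Gw : G w = p.[0] by rewrite -Gp scale0r addr0.
rewrite /= [t *: v + w]addrC Gp Gw pq !hornerD !hornerC !hornerM !hornerX.
by rewrite mul0r addr0 [_ + _ - _]addrC addKr /GRing.scale /= mulKf.
Unshelve. all: by end_near. Qed.
End AbstractComplex.

(** * The maximum norm on row vectors *)

Lemma rV_norm_leP (K : numFieldType) (n : nat) (y : 'rV[K]_n) (r : K) :
  0 <= r -> `|y| <= r <-> forall j, `|y 0 j| <= r.
Proof.
move=> /nonnegP[{}r]; rewrite [`|y|]mx_normE num_le.
split=> [/bigmax_leP[_ H] j|H]; first exact: (H (0, j) isT).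
apply/bigmax_leP => /=; split=> [|[i j] _]; first by rewrite -num_le /=.
by rewrite (ord1 i); exact: H.
Qed.

Lemma rV_norm_ltP (K : numFieldType) (n : nat) (y : 'rV[K]_n) (r : K) :
  0 < r -> `|y| < r <-> forall j, `|y 0 j| < r.
Proof.
move=> r_gt0; split=> [yr j|H].
  by apply: le_lt_trans yr; move: j; apply/rV_norm_leP.
change (mx_norm y < r); have [->|/mx_norm_neq0[[i j] /= ->]] := eqVneq (mx_norm y) 0.
  by [].
by rewrite (ord1 i).
Qed.

(** * Homogeneous expansions and termwise differentiation *)

Section PowerSeries.
Variable C : numClosedFieldType.
Hypothesis cvg_exprC : forall s : C, 0 <= s < 1 -> s ^+ N @[N --> \oo] --> 0.
Hypothesis compact_disc : forall r : C, compact [set x : C | `|x| <= r].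
Variable n : nat.
Local Notation Cn := 'rV[C]_n.

Lemma bounded_on_closed_polydisc (g : Cn -> C) (r : C) :
  (forall y, `|y| <= r -> {for y, continuous g}) ->
  exists M, forall y, `|y| <= r -> `|g y| <= M.
Proof.
move=> g_cont; have [r_ge0|r_lt0] := boolP (0 <= r); last first.
  by exists 0 => y yr; case/negP: r_lt0; exact: le_trans yr.
have /compact_near_coveringP cpt : compact [set y : Cn | forall j, `|y 0 j| <= r].
  by apply: (@rV_compact C n (fun=> [set x | `|x| <= r])).
have /= H := cpt C (pinfty_nbhs C) (fun M y => `|g y| <= M) _.
have [M [Mreal HM]] : \forall M \near +oo, [set y : Cn | forall j, `|y 0 j| <= r]
    `<=` (fun y => `|g y| <= M).
  apply: H => y /= yr; have {}yr : `|y| <= r by apply/rV_norm_leP.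
  have gy := g_cont y yr.
  (* Near [y] every [M] beyond the local bound works; compactness turns these local statements into
     one for all [y] at once. *)
  exists ([set z | `|g z| < `|g y| + 1], [set M | `|g y| + 1 < M]).
    split=> /=; first by apply: cvgr_norm_lt gy _ _; rewrite ltrDl.
    by apply: nbhs_pinfty_gt; rewrite realD // ?normr_real ?real1.
  by move=> [z M] /= [gz /(lt_trans gz)/ltW].
by exists (M + 1) => y yr; apply: HM; [rewrite ltrDl|apply/rV_norm_leP].
Qed.

(** The second clause stands in for being a polynomial map: along every line the function is a
    polynomial in the parameter, which suffices for directional derivatives and Cauchy estimates. *)
Definition homogeneous (l : nat) (G : Cn -> C) :=
  (forall x y, G (x *: y) = x ^+ l * G y) /\
  (forall y v, exists p : {poly C}, forall t, G (y + t *: v) = p.[t]).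

Lemma derive_homogeneous0 (G : Cn -> C) (w v : Cn) :
  homogeneous 0 G -> 'D_v G w = 0.
Proof.
move=> [G_hom _]; rewrite (@derive_along_poly _ _ _ _ _ (G 0)%:P).
  by rewrite derivC horner0.
by move=> t; rewrite hornerC -(scale0r (w + t *: v)) G_hom expr0 mul1r.
Qed.

(** If [p] describes [G] on the line through [w], then [x ^+ l.+1 * p (t / x)] describes it on the
    line through [x *: w]; the chain rule removes one power of [x]. *)
Lemma derive_homogeneous (l : nat) (G : Cn -> C) (x : C) (w v : Cn) :
  homogeneous l.+1 G -> x != 0 -> 'D_v G (x *: w) = x ^+ l * 'D_v G w.
Proof.
move=> [G_hom G_poly] x_neq0; have [p Gp] := G_poly w v.
rewrite (derive_along_poly Gp).
rewrite (@derive_along_poly _ _ _ _ _ (x ^+ l.+1 *: (p \Po (x^-1 *: 'X)))).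
  rewrite derivZ deriv_comp derivZ derivX hornerZ hornerM horner_comp !hornerZ.
  by rewrite hornerX mulr0 hornerC mulr1 exprSr; field.
move=> t; rewrite hornerZ horner_comp hornerZ hornerX -Gp -G_hom.
by rewrite scalerDr !scalerA mulVKf.
Qed.

Section TermwiseDerivative.
Variables (G : nat -> Cn -> C) (g : Cn -> C).
Hypothesis G_hom : forall l, homogeneous l (G l).
Hypothesis g_cont : forall y, `|y| < 1 -> {for y, continuous g}.
Hypothesis G_cvg : forall y, `|y| < 1 -> \sum_(l < L) G l y @[L --> \oo] --> g y.

Lemma series_terms_bounded (y : Cn) : `|y| < 1 -> exists2 B, 0 <= B & forall l, `|G l y| <= B.
Proof.
move=> /G_cvg gy.
have /cvg_seq_bounded/pinfty_ex_gt0[B B_gt0 HB] : cvgn (fun L => \sum_(l < L) G l y).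
  by apply/cvg_ex; exists (g y).
have {}HB L : `|\sum_(l < L) G l y| <= B by exact: HB.
have B_ge0 := ltW B_gt0.
exists (B + B) => [|l]; first exact: addr_ge0.
have -> : G l y = \sum_(i < l.+1) G i y - \sum_(i < l) G i y.
  by rewrite big_ord_recr /= addrAC subrr add0r.
by apply: le_trans (ler_normB _ _) _; apply: lerD.
Qed.

(** The values [G l y] are the Taylor coefficients of [x |-> g (x *: y)]. Their geometric decay
    comes from the boundedness of the terms at the larger point [s^-1 *: y], with [s] halfway
    between [r] and 1. *)
Lemma homogeneous_part_le_sup (r M : C) : 0 < r < 1 ->
  (forall y, `|y| <= r -> `|g y| <= M) ->
  forall l y, `|y| <= r -> `|G l y| <= M.
Proof.
move=> /andP[r_gt0 r_lt1] g_le l y yr.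
pose s := (r + 1) / 2.
have s_gt0 : 0 < s by rewrite divr_gt0 ?ltr0n // addr_gt0.
have rs : r < s by rewrite /s midf_lt.
have s_lt1 : s < 1 by rewrite /s midf_lt.
have ys : `|s^-1 *: y| < 1.
  rewrite normrZ normfV (gtr0_norm s_gt0) mulrC ltr_pdivrMr // mul1r.
  exact: le_lt_trans rs.
have [B B_ge0 HB] := series_terms_bounded ys.
apply: (@coef_le_sup _ cvg_exprC (fun i => G i y) (fun x => g (x *: y)) M B s) => //.
- by rewrite ltW.
- move=> i; rewrite -[y in G i y](scalerKV (lt0r_neq0 s_gt0)) (G_hom i).1.
  rewrite normrM normrX (gtr0_norm s_gt0) mulrC ler_wpM2r //.
  by rewrite exprn_ge0 // ltW.
- move=> x x1.
  rewrite (_ : (fun L => _) = fun L => \sum_(i < L) G i (x *: y)).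
    by apply: G_cvg; rewrite normrZ x1 mul1r; exact: le_lt_trans yr r_lt1.
  by apply/funext => L; apply: eq_bigr => i _; rewrite (G_hom i).1 mulrC.
- by move=> x x1; apply: g_le; rewrite normrZ x1 mul1r.
Qed.

(* Chosen so that |w| + radius w = rate w ^ 2. *)
Let rate (w : Cn) : C := (1 + `|w|) / 2.
Let radius (w : Cn) : C := (1 - `|w|) ^+ 2 / 4.

Let rate_gt0 w : 0 < rate w.
Proof. by rewrite divr_gt0 ?ltr0n // ltr_pwDl. Qed.

Let rate_lt1 w : `|w| < 1 -> rate w < 1.
Proof. by move=> w1; rewrite /rate addrC midf_lt. Qed.

Let radius_gt0 w : `|w| < 1 -> 0 < radius w.
Proof. by move=> w1; rewrite divr_gt0 ?ltr0n // exprn_gt0 // subr_gt0. Qed.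

(** Dividing [w + t *: v] by [s = rate w] gives norm at most [(|w| + radius w) / s = s], where the
    parts are bounded by the supremum of [g]; homogeneity returns the factor [s ^+ l]. *)
Lemma homogeneous_part_geometric (w : Cn) : `|w| < 1 ->
  exists2 M, 0 <= M & forall v t l, `|v| <= 1 -> `|t| <= radius w ->
    `|G l (w + t *: v)| <= M * rate w ^+ l.
Proof.
move=> w1; set s := rate w.
have s_gt0 : 0 < s := rate_gt0 w.
have s_lt1 : s < 1 := rate_lt1 w1.
have [M g_le] : exists M, forall y, `|y| <= s -> `|g y| <= M.
  by apply: bounded_on_closed_polydisc => y ys; apply: g_cont; exact: le_lt_trans s_lt1.
exists M => [|v t l v1 tr].
  by apply: (le_trans (normr_ge0 (g 0)) (g_le 0 _)); rewrite normr0 ltW.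
have ys : `|s^-1 *: (w + t *: v)| <= s.
  rewrite normrZ normfV (gtr0_norm s_gt0) mulrC ler_pdivrMr //.
  have -> : s * s = `|w| + radius w by rewrite /s /rate /radius; field.
  apply: le_trans (ler_normD _ _) _; rewrite lerD2l normrZ.
  by apply: le_trans tr; rewrite ler_piMr.
rewrite -[_ + _](scalerKV (lt0r_neq0 s_gt0)) (G_hom l).1.
rewrite normrM normrX (gtr0_norm s_gt0) mulrC ler_wpM2r //.
  by rewrite exprn_ge0 // ltW.
by apply: homogeneous_part_le_sup ys; rewrite ?s_gt0.
Qed.

Lemma derive_part_geometric (w : Cn) : `|w| < 1 ->
  exists2 K, 0 <= K &
    forall v l, `|v| <= 1 -> `|'D_v (G l) w| <= K * ((1 + `|w|) / 2) ^+ l.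
Proof.
move=> w1; have [M M_ge0 G_le] := homogeneous_part_geometric w1.
have r_gt0 := radius_gt0 w1.
exists (M / radius w) => [|v l v1]; first by rewrite divr_ge0 // ltW.
have [p Gp] := (G_hom l).2 w v.
rewrite (derive_along_poly Gp) horner_coef0 coef_deriv mulr1n mulrAC ler_pdivlMr //.
rewrite -[radius w]expr1; apply: poly_coef_le_sup => // t tr.
by rewrite -Gp; apply: G_le => //; rewrite tr.
Qed.

(** The difference quotients of the partial sums approach their derivatives uniformly in [L], which
    allows the limits in [t] and [L] to be exchanged. *)
Lemma cvg_derive_series (w v : Cn) : `|w| < 1 -> `|v| <= 1 -> derivable g w v ->
  \sum_(l < L) 'D_v (G l) w @[L --> \oo] --> 'D_v g w.
Proof.
move=> w1 v1 dg; have [M M_ge0 G_le] := homogeneous_part_geometric w1.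
have r_gt0 := radius_gt0 w1; set r := radius w in G_le r_gt0.
have s_gt0 := rate_gt0 w; have s_lt1 := rate_lt1 w1.
set s := rate w in G_le s_gt0 s_lt1.
have r2_ge0 : 0 <= 2 / r ^+ 2 by rewrite divr_ge0 ?ler0n // exprn_ge0 // ltW.
pose B := M * (2 / r ^+ 2) / (1 - s).
have B_ge0 : 0 <= B.
  by apply: divr_ge0; [exact: mulr_ge0 | rewrite subr_ge0 ltW].
have r2_gt0 : 0 < r / 2 by rewrite divr_gt0 ?ltr0n.
(* The degree-[l] part has a quadratic Taylor remainder with constant proportional to [s ^+ l];
   these sum to a [B] independent of [L]. *)
have remainder t L : `|t| <= r / 2 ->
    `|\sum_(l < L) G l (w + t *: v) - \sum_(l < L) G l w
      - (\sum_(l < L) 'D_v (G l) w) * t| <= B * `|t| ^+ 2.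
  move=> tr; rewrite mulr_suml -!sumrB.
  apply: le_trans (ler_norm_sum _ _ _) _.
  apply: (@le_trans _ _ (\sum_(0 <= l < L) M * s ^+ l * (2 / r ^+ 2) * `|t| ^+ 2)).
    rewrite big_mkord; apply: ler_sum => l _.
    have [p Gp] := (G_hom l).2 w v.
    have Gw : G l w = p`_0 by rewrite -horner_coef0 -Gp scale0r addr0.
    rewrite Gp Gw (derive_along_poly Gp) horner_coef0 coef_deriv mulr1n.
    apply: poly_taylor1_le => // x xr; rewrite -Gp; apply: G_le => //.
    by rewrite xr.
  rewrite -2!mulr_suml -mulr_sumr ler_wpM2r ?exprn_ge0 //.
  rewrite /B [leRHS]mulrAC ler_wpM2r //.
  rewrite ler_wpM2l //.
  have s01 : 0 <= s < 1 by rewrite s_lt1 ltW.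
  by apply: le_trans (geometric_tail_le 0 L s01) _; rewrite expr0 mul1r.
apply/cvgrPdist_le => e e_gt0; have e3_gt0 : 0 < e / 3 by rewrite divr_gt0 ?ltr0n.
have B1_gt0 : 0 < B + 1 by rewrite ltr_wpDl.
have eB_gt0 : 0 < e / 3 / (B + 1) by rewrite divr_gt0.
have dg_cvg : t^-1 *: (g (t *: v + w) - g w) @[t --> 0^'] --> 'D_v g w by exact: dg.
have neq0 : \forall t \near (0 : C)^', t != 0.
  by near=> t; near: t; exact: nbhs_dnbhs_neq.
have small (u : C) : 0 < u -> \forall t \near (0 : C)^', `|t| <= u.
  move=> u_gt0; apply: cvg_within.
  exact: (@cvgr0_norm_le C C C (nbhs (0 : C)) _ id (@cvg_id _ _) u u_gt0).
(* A single increment [t] is fixed first; [L] is chosen afterwards, depending on it. Each of the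
   three errors is at most [e / 3]. *)
have /filter_ex[t [/= [t_neq0 tr] [te Dt]]] : \forall t \near (0 : C)^',
    (t != 0 /\ `|t| <= r / 2) /\ (`|t| <= e / 3 / (B + 1) /\
    `|'D_v g w - t^-1 *: (g (t *: v + w) - g w)| <= e / 3).
  apply: filterI; apply: filterI; [exact: neq0|exact: small|exact: small|].
  by move/cvgrPdist_le: dg_cvg; exact.
have wt1 : `|w + t *: v| < 1.
  apply: (@le_lt_trans _ _ (s * s)); last by rewrite mulr_ilt1 // ltW.
  have -> : s * s = `|w| + r by rewrite /s /r /rate /radius; field.
  apply: le_trans (ler_normD _ _) _; rewrite lerD2l normrZ.
  apply: (@le_trans _ _ (r / 2)); first by apply: le_trans tr; rewrite ler_piMr.
  by rewrite ler_pdivrMr ?ltr0n // ler_peMr ?ltW // ltr1n.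
have quot_cvg : t^-1 *: (\sum_(l < L) G l (w + t *: v) - \sum_(l < L) G l w)
    @[L --> \oo] --> t^-1 *: (g (w + t *: v) - g w).
  by apply: cvgZr; apply: cvgB; exact: G_cvg.
near=> L.
have quot_L : `|t^-1 *: (g (w + t *: v) - g w)
    - t^-1 *: (\sum_(l < L) G l (w + t *: v) - \sum_(l < L) G l w)| <= e / 3.
  by near: L; move/cvgrPdist_le: quot_cvg; exact.
have rem_L : `|t^-1 *: (\sum_(l < L) G l (w + t *: v) - \sum_(l < L) G l w)
    - \sum_(l < L) 'D_v (G l) w| <= e / 3.
  have t_gt0 : 0 < `|t| by rewrite normr_gt0.
  rewrite -(ler_pM2r t_gt0) -normrM mulrBl /GRing.scale /= mulrAC mulVf // mul1r.
  apply: le_trans (remainder t L tr) _; rewrite expr2 mulrA ler_wpM2r //.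
  apply: le_trans (_ : (B + 1) * (e / 3 / (B + 1)) <= _).
    by apply: ler_pM => //; rewrite lerDl.
  by rewrite mulrCA divff ?mulr1 ?lt0r_neq0.
rewrite addrC in Dt; rewrite [t *: v + w]addrC in Dt.
have -> : e = e / 3 + e / 3 + e / 3 by field.
apply: le_trans (ler_distD (t^-1 *: (\sum_(l < L) G l (w + t *: v)
  - \sum_(l < L) G l w)) _ _) _.
rewrite lerD //.
apply: le_trans (ler_distD (t^-1 *: (g (w + t *: v) - g w)) _ _) _.
by rewrite lerD // addrC.
Unshelve. all: by end_near. Qed.

End TermwiseDerivative.
End PowerSeries.

(** * Closure properties of homogeneous functions, and the derivative of a section *)

Section Homogeneous.
Variables (C : numClosedFieldType) (n : nat).
Local Notation Cn := 'rV[C]_n.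
Implicit Types G : Cn -> C.

Lemma homogeneous_coord (j : 'I_n) : homogeneous 1 (fun y : Cn => y 0 j).
Proof.
split=> [x y|y v]; first by rewrite mxE.
exists ((y 0 j)%:P + 'X * (v 0 j)%:P) => t.
by rewrite !mxE hornerD hornerM hornerX !hornerC.
Qed.

Lemma homogeneous0 l : homogeneous l (fun _ : Cn => 0).
Proof. by split=> [x y|y v]; [rewrite mulr0 | exists 0 => t; rewrite horner0]. Qed.

Lemma homogeneous_cst c : homogeneous 0 (fun _ : Cn => c).
Proof. by split=> [x y|y v]; [rewrite mul1r | exists c%:P => t; rewrite hornerC]. Qed.

Lemma homogeneousD l G1 G2 : homogeneous l G1 -> homogeneous l G2 ->
  homogeneous l (fun y => G1 y + G2 y).
Proof.
move=> [h1 p1] [h2 p2]; split=> [x y|y v]; first by rewrite h1 h2 mulrDr.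
have [q1 H1] := p1 y v; have [q2 H2] := p2 y v.
by exists (q1 + q2) => t; rewrite hornerD H1 H2.
Qed.

Lemma homogeneousM l1 l2 G1 G2 : homogeneous l1 G1 -> homogeneous l2 G2 ->
  homogeneous (l1 + l2) (fun y => G1 y * G2 y).
Proof.
move=> [h1 p1] [h2 p2]; split=> [x y|y v]; first by rewrite h1 h2 exprD mulrACA.
have [q1 H1] := p1 y v; have [q2 H2] := p2 y v.
by exists (q1 * q2) => t; rewrite hornerM H1 H2.
Qed.

Lemma homogeneousX l G m : homogeneous l G -> homogeneous (m * l) (fun y => G y ^+ m).
Proof.
move=> hG; elim: m => [|m ih]; first exact: homogeneous_cst.
have := homogeneousM hG ih.
by rewrite mulSn (_ : (fun y => _ * _) = fun y => G y ^+ m.+1) //;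
  apply/funext => y; rewrite exprS.
Qed.

Lemma homogeneous_sum (I : Type) (r : seq I) (P : pred I) l (G : I -> Cn -> C) :
  (forall i, P i -> homogeneous l (G i)) ->
  homogeneous l (fun y => \sum_(i <- r | P i) G i y).
Proof.
move=> hG; elim: r => [|i r ih].
  by under eq_fun do rewrite big_nil; exact: homogeneous0.
case Pi : (P i); under eq_fun do rewrite big_cons Pi; last exact: ih.
by apply: homogeneousD => //; exact: hG.
Qed.

Lemma homogeneous_prod (I : Type) (r : seq I) (l : I -> nat) (G : I -> Cn -> C) :
  (forall i, homogeneous (l i) (G i)) ->
  homogeneous (\sum_(i <- r) l i) (fun y => \prod_(i <- r) G i y).
Proof.
move=> hG; elim: r => [|i r ih].
  by rewrite big_nil; under eq_fun do rewrite big_nil; exact: homogeneous_cst.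
rewrite big_cons (_ : (fun y => _) = fun y => G i y * \prod_(j <- r) G j y).
  exact: homogeneousM.
by apply/funext => y; rewrite big_cons.
Qed.

Lemma derive_homogeneous_sum (w v : Cn) (r : seq nat) (G : nat -> Cn -> C) :
  (forall m, homogeneous m (G m)) ->
  'D_v (fun y => \sum_(m <- r) G m y) w = \sum_(m <- r) 'D_v (G m) w.
Proof.
move=> hG; have /choice[p Gp] := fun m => (hG m).2 w v.
rewrite (@derive_along_poly _ _ _ _ _ (\sum_(m <- r) p m)); last first.
  by move=> t; rewrite horner_sum; apply: eq_bigr => m _.
rewrite raddf_sum horner_sum; apply: eq_bigr => m _.
by rewrite (derive_along_poly (Gp m)).
Qed.

Lemma norm_delta_rV_le1 (k : 'I_n) : `|delta_mx 0 k : Cn| <= 1.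
Proof.
by apply/rV_norm_leP => // j; rewrite mxE /=; case: eqP; rewrite ?normr0 ?normr1.
Qed.

Lemma sum_half_powers (q : nat) :
  \sum_(1 <= i < q.+1) (2^-1 : C) ^+ i = 1 - 2^-1 ^+ q.
Proof.
elim: q => [|q ih]; first by rewrite big_geq // expr0 subrr.
by rewrite big_nat_recr //= ih exprS; field.
Qed.

(** A derivative of the degree-[m] part has degree [m - 1], so passing from [2 *: z] to [z] gains
    [2 ^- m.-1]. Strictness holds because a finite sum of these weights from [m = 2] stays below
    1. *)
Lemma sum_derive_section_lt (G : nat -> Cn -> C) (z : Cn) (B : C) (q : nat) :
  0 < B -> (forall m, homogeneous m (G m)) ->
  (forall l, \sum_(k < n) `|'D_(delta_mx 0 k) (G l.+1) (2 *: z)| <= B) ->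
  \sum_(k < n) `|'D_(delta_mx 0 k) (fun y => \sum_(2 <= m < q.+1) G m y) z| < B.
Proof.
move=> B_gt0 G_hom G_le.
have two_neq0 : 2 != 0 :> C by rewrite pnatr_eq0.
apply: (@le_lt_trans _ _ (\sum_(2 <= m < q.+1) B * 2^-1 ^+ m.-1)).
  apply: (@le_trans _ _ (\sum_(k < n) \sum_(2 <= m < q.+1)
      `|'D_(delta_mx 0 k) (G m) z|)).
    by apply: ler_sum => k _; rewrite derive_homogeneous_sum // ler_norm_sum.
  rewrite exchange_big /=; apply: ler_sum_nat => -[//|m] _ /=.
  rewrite exprVn ler_pdivlMr ?exprn_gt0 ?ltr0n // mulr_suml.
  apply: le_trans (G_le m); apply: ler_sum => k _.
  by rewrite (derive_homogeneous _ _ (G_hom m.+1)) // normrM normrX normr_nat mulrC.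
case: q => [|q]; first by rewrite big_geq.
by rewrite -mulr_sumr big_add1 /= sum_half_powers gtr_pMr // gtrBl exprn_gt0.
Qed.

End Homogeneous.

(** * Bounds on the homogeneous parts, and uniqueness of the decomposition *)

Section PositiveRealPart.
Variable C : numClosedFieldType.
Hypothesis cvg_exprC : forall s : C, 0 <= s < 1 -> s ^+ N @[N --> \oo] --> 0.
Hypothesis compact_disc : forall r : C, compact [set x : C | `|x| <= r].
Variable n : nat.
Local Notation Cn := 'rV[C]_n.
Local Notation e k := (delta_mx 0 k : Cn).

(** The degree-0 part has zero derivative, hence the shift of index; homogeneity extracts [x ^+ l]
    and exhibits a power series in [x]. *)
Lemma cvg_derive_series_circle (G : nat -> Cn -> C) (g : Cn -> C) (w v : Cn) (x : C) :
  (forall l, homogeneous l (G l)) ->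
  (forall y, `|y| < 1 -> differentiable g y) ->
  (forall y, `|y| < 1 -> \sum_(l < L) G l y @[L --> \oo] --> g y) ->
  `|w| < 1 -> `|v| <= 1 -> `|x| = 1 ->
  \sum_(l < L) 'D_v (G l.+1) w * x ^+ l @[L --> \oo] --> 'D_v g (x *: w).
Proof.
move=> G_hom g_diff G_cvg w1 v1 x1.
have xw1 : `|x *: w| < 1 by rewrite normrZ x1 mul1r.
have x_neq0 : x != 0 by rewrite -normr_eq0 x1 oner_eq0.
have := @cvg_derive_series _ cvg_exprC compact_disc n G g G_hom
  (fun y y1 => differentiable_continuous (g_diff y y1)) G_cvg _ v xw1 v1
  (diff_derivable (g_diff _ xw1)).
rewrite -cvg_shiftS; apply: cvg_trans; apply: near_eq_cvg; apply: nearW => L.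
rewrite /= big_ord_recl (derive_homogeneous0 _ _ (G_hom 0%N)) add0r.
by apply: eq_bigr => l _; rewrite (derive_homogeneous _ _ (G_hom l.+1)) // mulrC.
Qed.

Lemma sum_derive_part_le (G H : nat -> Cn -> C) (g h : Cn -> C) (A : C) (w : Cn) :
  A \is Num.real ->
  (forall l, homogeneous l (G l)) -> (forall l, homogeneous l (H l)) ->
  (forall y, `|y| < 1 -> differentiable g y) ->
  (forall y, `|y| < 1 -> differentiable h y) ->
  (forall y, `|y| < 1 -> \sum_(l < L) G l y @[L --> \oo] --> g y) ->
  (forall y, `|y| < 1 -> \sum_(l < L) H l y @[L --> \oo] --> h y) ->
  (forall y, `|y| < 1 ->
    \sum_(k < n) `|'D_(e k) g y| <= 'Re (\sum_(k < n) 'D_(e k) h y) - A) ->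
  `|w| < 1 -> forall l, \sum_(k < n) `|'D_(e k) (G l.+1) w|
    <= 'Re (\sum_(k < n) 'D_(e k) (H 1%N) w) - A.
Proof.
move=> A_real G_hom H_hom g_diff h_diff G_cvg H_cvg gh w1.
have [Kg Kg_ge0 G_le] := @derive_part_geometric _ cvg_exprC compact_disc n G g G_hom
  (fun y y1 => differentiable_continuous (g_diff y y1)) G_cvg _ w1.
have [Kh Kh_ge0 H_le] := @derive_part_geometric _ cvg_exprC compact_disc n H h H_hom
  (fun y y1 => differentiable_continuous (h_diff y y1)) H_cvg _ w1.
set s := (1 + `|w|) / 2 in G_le H_le.
have s_ge0 : 0 <= s by rewrite divr_ge0 ?ler0n // addr_ge0.
have s_lt1 : s < 1 by rewrite /s addrC midf_lt.
have sS (K : C) l : 0 <= K -> K * s ^+ l.+1 <= K * s ^+ l.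
  by move=> K_ge0; rewrite ler_wpM2l // exprSr ler_piMr ?exprn_ge0 // ltW.
have Khn_ge0 : 0 <= Kh *+ n by rewrite mulrn_wge0.
(* The constant coefficient of the dominating series comes from the linear part [H 1]. The constant
   [Kg + Kh *+ n] covers both the [n] series of [g] and the summed series of [h]. *)
apply: (@sum_coef_le_Re _ cvg_exprC n (fun k l => 'D_(e k) (G l.+1) w)
  (fun k x => 'D_(e k) g (x *: w)) (fun l => \sum_(k < n) 'D_(e k) (H l.+1) w)
  (fun x => \sum_(k < n) 'D_(e k) h (x *: w)) A (Kg + Kh *+ n) s) => //.
- exact: addr_ge0.
- by rewrite s_ge0.
- move=> k l; apply: le_trans (G_le _ l.+1 (norm_delta_rV_le1 C k)) _.
  by apply: le_trans (sS _ _ Kg_ge0) _; rewrite ler_wpM2r ?exprn_ge0 // lerDl.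
- move=> l; apply: le_trans (ler_norm_sum _ _ _) _.
  apply: (@le_trans _ _ (\sum_(k < n) Kh * s ^+ l)).
    apply: ler_sum => k _; apply: le_trans (H_le _ l.+1 (norm_delta_rV_le1 C k)) _.
    exact: sS.
  by rewrite sumr_const card_ord -mulrnAl ler_wpM2r ?exprn_ge0 // lerDr.
- by move=> x k x1; apply: cvg_derive_series_circle => //; exact: norm_delta_rV_le1.
- move=> x x1; rewrite (_ : (fun L => _) = fun L =>
      \sum_(k < n) \sum_(l < L) 'D_(e k) (H l.+1) w * x ^+ l); last first.
    by apply/funext => L; under eq_bigr do rewrite mulr_suml; rewrite exchange_big.
  apply: cvg_big => [|k _]; first exact: add_continuous.
  by apply: cvg_derive_series_circle => //; exact: norm_delta_rV_le1.
- by move=> x x1; apply: gh; rewrite normrZ x1 mul1r.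
Qed.

(* For an increment t the difference quotient of u is conj t / t times the
   conjugate of that of v; this factor is 1 for real t and -1 for imaginary t. *)
Lemma derive_conj_eq0 (u v : Cn -> C) (z d : Cn) :
  derivable u z d -> derivable v z d ->
  (\forall y \near z, u y = (v y)^*) -> 'D_d u z = 0.
Proof.
move=> du dv uv.
have uvz : u z = (v z)^* by exact: nbhs_singleton uv.
set a := 'D_d u z; set b := 'D_d v z.
suff le_eps (eps : C) : 0 < eps -> `|a| <= eps *+ 2.
  apply/eqP; apply/negPn/negP => a_neq0.
  have a_gt0 : 0 < `|a| by rewrite normr_gt0.
  have := le_eps (`|a| / 4); rewrite divr_gt0 ?ltr0n // => /(_ isT).
  have -> : (`|a| / 4) *+ 2 = `|a| / 2 by rewrite -mulr_natr; field.
  have a_half : `|a| / 2 < `|a| by rewrite ltr_pdivrMr ?ltr0n // ltr_pMr // ltr1n.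
  by move=> /le_lt_trans/(_ a_half); rewrite ltxx.
move=> eps_gt0.
have uv_line : \forall t \near (0 : C)^', u (t *: d + z) = (v (t *: d + z))^*.
  apply: cvg_within; have : t *: d + z @[t --> (0 : C)] --> 0 *: d + z.
    exact: (cvgD (@scalel_continuous C Cn d 0) (cvg_cst z)).
  by rewrite scale0r add0r => /(_ _ uv).
have /cvgrPdist_le/(_ eps eps_gt0) a_near :
  t^-1 *: (u (t *: d + z) - u z) @[t --> 0^'] --> a by exact: du.
have /cvgrPdist_le/(_ eps eps_gt0) b_near :
  t^-1 *: (v (t *: d + z) - v z) @[t --> 0^'] --> b by exact: dv.
have [r /= r_gt0 r_ball] := filterI uv_line (filterI a_near b_near).
have r2_gt0 : 0 < r / 2 by rewrite divr_gt0 ?ltr0n.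
have r2_neq0 := lt0r_neq0 r2_gt0.
(* The factor [t^-1 * t^*] has modulus 1, so each of the two difference quotients contributes at
   most [eps]. *)
have quot (t : C) : `|t| = r / 2 -> `|a - t^-1 * t^* * b^*| <= eps *+ 2.
  move=> tr; have t_neq0 : t != 0 by rewrite -normr_eq0 tr.
  have tC_neq0 : t^* != 0 by rewrite conjC_eq0.
  have [|uvt [at_le bt_le]] := r_ball t _ t_neq0.
    by rewrite /= sub0r normrN tr ltr_pdivrMr ?ltr0n // ltr_pMr // ltr1n.
  apply: le_trans (ler_distD (t^-1 *: (u (t *: d + z) - u z)) _ _) _.
  rewrite mulr2n lerD // uvt uvz /GRing.scale /= -rmorphB.
  have -> : t^-1 * (v (t *: d + z) - v z)^* - t^-1 * t^* * b^* =
      - (t^-1 * t^*) * (b - t^-1 * (v (t *: d + z) - v z))^*.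
    move: (v _ - v _) => X; rewrite rmorphB rmorphM fmorphV.
    by field; rewrite ?t_neq0 ?tC_neq0.
  rewrite normrM normrN normrM normfV !norm_conjC mulVf ?normr_eq0 // mul1r.
  exact: bt_le.
have := quot (r / 2) (gtr0_norm r2_gt0).
rewrite (conj_Creal (gtr0_real r2_gt0)) mulVf // mul1r => H1.
have := quot ('i * (r / 2)); rewrite normrM normCi mul1r (gtr0_norm r2_gt0).
have tC : ('i * (r / 2))^* = - 'i * (r / 2).
  by rewrite rmorphM /= conjCi (conj_Creal (gtr0_real r2_gt0)).
move=> /(_ erefl); rewrite tC.
have -> : ('i * (r / 2))^-1 * (- 'i * (r / 2)) = -1.
  by field; rewrite neq0Ci lt0r_neq0.
rewrite mulN1r opprK => H2.
rewrite -(ler_pM2r (_ : 0 < 2)) ?ltr0n // mulr_natr.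
(* Adding the estimates for real and imaginary [t] eliminates [b]. *)
have -> : `|a| *+ 2 = `|(a - b^*) + (a + b^*)|.
  by rewrite addrACA addNr addr0 -mulr2n normrMn.
apply: le_trans (ler_normD _ _) _; rewrite mulr_natr mulr2n.
exact: lerD.
Unshelve. all: by end_near. Qed.
(** The class inequality is given for some decomposition, the expansions for another; this
    identifies their derivatives. Here [h - h1] is the conjugate of [g1 - g], so both have zero
    derivative. *)
Lemma derive_pluriharmonic_unique (h g h1 g1 : Cn -> C) (z d : Cn) : `|z| < 1 ->
  derivable h z d -> derivable g z d -> derivable h1 z d -> derivable g1 z d ->
  (forall y, `|y| < 1 -> h y + (g y)^* = h1 y + (g1 y)^*) ->
  'D_d h z = 'D_d h1 z /\ 'D_d g z = 'D_d g1 z.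
Proof.
move=> z1 dh dg dh1 dg1 E.
have near1 : \forall y \near z, `|y| < 1 by exact: cvgr_norm_lt (@cvg_id _ _) _ z1.
have du := derivableB dh dh1; have dv := derivableB dg1 dg.
have uv y : `|y| < 1 -> (h - h1) y = ((g1 - g) y)^*.
  move=> /E Ey; rewrite !fctE rmorphB; apply/eqP.
  by rewrite subr_eq addrAC eq_sym subr_eq eq_sym Ey addrC.
split; apply/eqP; rewrite -subr_eq0.
  rewrite -deriveB // (derive_conj_eq0 du dv) //.
  by apply: filterS near1; exact: uv.
rewrite -oppr_eq0 opprB -deriveB // (derive_conj_eq0 dv du) //.
by apply: filterS near1 => y /uv ->; rewrite conjCK.
Qed.

Lemma cvg_tail_series (G : nat -> Cn -> C) (L1 g : Cn -> C) (y : Cn) :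
  L1 y + \sum_(2 <= m < N.+1) G m y @[N --> \oo] --> g y ->
  \sum_(l < L) [eta G with 0%N |-> fun=> 0, 1%N |-> L1] l y @[L --> \oo] --> g y.
Proof.
rewrite -(cvg_shiftS (fun L => \sum_(l < L) _)).
apply: cvg_trans; apply: near_eq_cvg; near=> N.
have N1 : (1 < N.+1)%N by rewrite ltnS; near: N; exact: nbhs_infty_gt.
rewrite /=; set F := [eta G with 0%N |-> fun=> 0, 1%N |-> L1].
have -> : \sum_(l < N.+1) F l y = F 0%N y + (F 1%N y + \sum_(2 <= m < N.+1) F m y).
  by rewrite -(big_mkord xpredT (fun l => F l y)) big_ltn // big_ltn.
rewrite /F /= add0r; congr (_ + _).
by apply: eq_big_nat => -[|[|m]].
Unshelve. all: by end_near. Qed.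

Lemma sum_derive_section_lt_linear (G H : nat -> Cn -> C) (L1 f h g h1 g1 : Cn -> C)
    (alpha : C) (q : nat) (z : Cn) :
  (0 < n)%N -> alpha \is Num.real -> alpha < 1 ->
  (forall m, homogeneous m (G m)) -> (forall m, homogeneous m (H m)) ->
  homogeneous 1 L1 -> (forall (y : Cn) k, 'D_(e k) L1 y = 1) ->
  (forall y : Cn, (forall j, `|y 0 j| < 1) -> differentiable h y) ->
  (forall y : Cn, (forall j, `|y 0 j| < 1) -> differentiable g y) ->
  (forall y : Cn, (forall j, `|y 0 j| < 1) -> f y = h y + (g y)^*) ->
  (forall y : Cn, (forall j, `|y 0 j| < 1) -> differentiable h1 y) ->
  (forall y : Cn, (forall j, `|y 0 j| < 1) -> differentiable g1 y) ->
  (forall y : Cn, (forall j, `|y 0 j| < 1) -> f y = h1 y + (g1 y)^*) ->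
  (forall y : Cn, (forall j, `|y 0 j| < 1) ->
    \sum_(k < n) `|'D_(e k) g1 y| < \sum_(k < n) 'Re ('D_(e k) h1 y - alpha)) ->
  (forall y : Cn, (forall j, `|y 0 j| < 1) ->
    L1 y + \sum_(2 <= m < N.+1) H m y @[N --> \oo] --> h y) ->
  (forall y : Cn, (forall j, `|y 0 j| < 1) ->
    \sum_(2 <= m < N.+1) G m y @[N --> \oo] --> g y) ->
  `|z| < (2 * n%:R ^+ 2)^-1 ->
  \sum_(k < n) `|'D_(e k) (fun y => \sum_(2 <= m < q.+1) G m y) z|
    < \sum_(k < n) 'Re ('D_(e k) L1 z - alpha).
Proof.
move=> n_gt0 alpha_real alpha_lt1 G_hom H_hom L1_hom L1_der hd gd fE h1d g1d f1E.
move=> pos hE gE z_lt.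
have pd (y : Cn) : `|y| < 1 -> forall j, `|y 0 j| < 1 by move/rV_norm_ltP; apply.
(* Since [n >= 1], the radius [1 / (2 n^2)] is at most [1/2]. *)
have z2 : `|2 *: z| < 1.
  rewrite normrZ normr_nat -ltr_pdivlMl ?ltr0n // mulr1.
  apply: lt_le_trans z_lt _; rewrite lef_pV2 ?posrE ?mulr_gt0 ?exprn_gt0 ?ltr0n //.
  by rewrite ler_peMr ?ler0n // exprn_ege1 // ler1n.
pose G' := [eta G with 0%N |-> fun=> 0, 1%N |-> fun=> 0].
(* The given expansions start at degree 2; degrees 0 and 1 are overwritten so that each function has
   a full series indexed from 0. *)
pose H' := [eta H with 0%N |-> fun=> 0, 1%N |-> L1].
have G'_hom m : homogeneous m (G' m).
  by case: m => [|[|m]] /=; [exact: homogeneous0 | exact: homogeneous0 | exact: G_hom].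
have H'_hom m : homogeneous m (H' m).
  by case: m => [|[|m]] /=; [exact: homogeneous0 | exact: L1_hom | exact: H_hom].
have G'_cvg y : `|y| < 1 -> \sum_(l < L) G' l y @[L --> \oo] --> g y.
  move=> /pd y1; apply: (@cvg_tail_series G (fun=> 0)).
  by under eq_fun do rewrite add0r; exact: gE.
have H'_cvg y : `|y| < 1 -> \sum_(l < L) H' l y @[L --> \oo] --> h y.
  by move=> /pd y1; apply: cvg_tail_series; exact: hE.
have re_sum (D : 'I_n -> C) :
    \sum_(k < n) 'Re (D k - alpha) = 'Re (\sum_(k < n) D k) - alpha *+ n.
  rewrite raddf_sum -[n in _ *+ n]card_ord -sumr_const -sumrB.
  by apply: eq_bigr => k _; rewrite raddfB /= (Creal_ReP _ alpha_real).
have alphan_real : alpha *+ n \is Num.real by rewrite rpredMn.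
have gh y : `|y| < 1 ->
    \sum_(k < n) `|'D_(e k) g y| <= 'Re (\sum_(k < n) 'D_(e k) h y) - alpha *+ n.
  move=> y1; have py := pd y y1.
  have E k : 'D_(e k) h y = 'D_(e k) h1 y /\ 'D_(e k) g y = 'D_(e k) g1 y.
    apply: derive_pluriharmonic_unique => //; try exact: diff_derivable.
    - exact/diff_derivable/hd.
    - exact/diff_derivable/gd.
    - exact/diff_derivable/h1d.
    - exact/diff_derivable/g1d.
    - by move=> x /pd px; rewrite -fE // f1E.
  rewrite -re_sum; under eq_bigr do rewrite (E _).2.
  by under [in leRHS]eq_bigr do rewrite (E _).1; apply/ltW/pos.
have key := sum_derive_part_le alphan_real G'_hom H'_hom
  (fun y y1 => gd y (pd y y1)) (fun y y1 => hd y (pd y y1)) G'_cvg H'_cvg gh z2.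
(* The averaged bound at [2 *: z] and the right-hand side of the goal at [z] are the same number
   [n (1 - alpha)]. *)
have L1E y : 'Re (\sum_(k < n) 'D_(e k) L1 y) - alpha *+ n = (1 - alpha) *+ n.
  rewrite (eq_bigr (fun=> 1)) => [|k _]; last exact: L1_der.
  by rewrite sumr_const card_ord mulrnBl (Creal_ReP _ _) // realn.
rewrite re_sum L1E; rewrite /= L1E in key.
have -> : (fun y => \sum_(2 <= m < q.+1) G m y) = fun y => \sum_(2 <= m < q.+1) G' m y.
  by apply/funext => y; apply: eq_big_nat => -[|[|m]].
by apply: sum_derive_section_lt key => //; rewrite pmulrn_lgt0 // subr_gt0.
Qed.

End PositiveRealPart.

(** * Compact discs and geometric convergence in the complex numbers *)

Lemma closed_norm_le (K : numFieldType) (r : K) : closed [set x : K | `|x| <= r].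
Proof.
rewrite closedE => p /= Hp; apply: contrapT => pr; apply: Hp.
have [r_ge0|r_ge0] := boolP (0 <= r); last first.
  by apply: (@filterE _ (nbhs p)) => x /(le_trans (normr_ge0 _)); exact/negP.
move/negP: pr; rewrite -real_ltNge ?normr_real ?ger0_real // => rp.
have near_rp : \forall x \near p, r < `|x| by exact: cvgr_norm_gt (@cvg_id _ _) _ rp.
by apply: (@filterS _ (nbhs p) _ _ _ _ near_rp) => x rx /(lt_le_trans rx); rewrite ltxx.
Qed.

Lemma cvg_rect (K : numClosedFieldType) (T : Type) (F : set_system T)
    (FF : Filter F) (f g : T -> K) (a b : K) :
  f x @[x --> F] --> a -> g x @[x --> F] --> b ->
  f x + 'i * g x @[x --> F] --> a + 'i * b.
Proof. by move=> fa gb; apply: cvgD; [exact: fa | apply: cvgMr; exact: gb]. Qed.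

Section ComplexNumbers.
Variable R : realType.
Local Notation C := (Cplx R).

Lemma toC_is_additive : zmod_morphism (@toC R).
Proof. by move=> x y; rewrite /toC rmorphB. Qed.
Lemma toC_is_monoid : monoid_morphism (@toC R).
Proof. by split=> [|x y]; rewrite /toC ?rmorph1 ?rmorphM. Qed.
HB.instance Definition _ := GRing.isZmodMorphism.Build R C (@toC R) toC_is_additive.
HB.instance Definition _ := GRing.isMonoidMorphism.Build R C (@toC R) toC_is_monoid.

Lemma toC_le (x y : R) : (toC x <= toC y) = (x <= y).
Proof. exact: lecR. Qed.

Lemma toC_lt (x y : R) : (toC x < toC y) = (x < y).
Proof. exact: ltcR. Qed.

Lemma real_toC (x : C) : x \is Num.real -> exists r : R, x = toC r.
Proof. by move/complex_realP. Qed.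

Lemma toC_real (x : R) : toC x \is Num.real.
Proof. by apply/complex_realP; exists x. Qed.

Lemma norm_toC (x : R) : `|toC x| = toC `|x|.
Proof.
have [x_ge0|x_lt0] := lerP 0 x.
  by rewrite (ger0_norm x_ge0) ger0_norm // -(rmorph0 (@toC R)) toC_le.
by rewrite (ltr0_norm x_lt0) ltr0_norm ?rmorphN // -(rmorph0 (@toC R)) toC_lt.
Qed.

Lemma toC_continuous : continuous (@toC R : R -> C).
Proof.
move=> x; apply/cvgrPdist_le => eps eps_gt0.
have [r epsE] := real_toC (gtr0_real eps_gt0); rewrite epsE in eps_gt0 *.
have r_gt0 : 0 < r by rewrite -toC_lt rmorph0.
near=> y; rewrite -rmorphB norm_toC toC_le; near: y.
exact: cvgr_dist_le (@cvg_id _ _) _ r_gt0.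
Unshelve. all: by end_near. Qed.

Lemma cvg_expr_Cplx (s : C) : 0 <= s < 1 -> s ^+ N @[N --> \oo] --> 0.
Proof.
case/andP=> s_ge0; have [r sE] := real_toC (ger0_real s_ge0).
move: s_ge0; rewrite {}sE -(rmorph0 (@toC R)) -(rmorph1 (@toC R)) toC_le toC_lt.
move=> r_ge0 r_lt1.
rewrite (_ : (fun N => _) = @toC R \o (fun N => r ^+ N)); last first.
  by apply/funext => N /=; rewrite rmorphXn.
apply: continuous_cvg; first exact: toC_continuous.
by apply: cvg_expr; rewrite ger0_norm.
Qed.

(** The disc is a closed subset of the continuous image of the real square [[-s, s]^2]; if [r] is
    not a nonnegative real it is empty. *)
Lemma compact_disc_Cplx (r : C) : compact [set x : C | `|x| <= r].
Proof.
have [r_ge0|r_ge0] := boolP (0 <= r); last first.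
  rewrite (_ : mkset _ = set0); first exact: compact0.
  rewrite -subset0 => x /(le_trans (normr_ge0 _)); exact/negP.
have [s rE] := real_toC (ger0_real r_ge0).
pose rect (p : R * R) : C := toC p.1 + 'i * toC p.2.
have rect_cont : continuous rect.
  case=> x y; apply: (@cvg_rect C _ _ _ (fun p : R * R => toC p.1) (fun p => toC p.2)).
    exact: (@cvg_comp _ _ _ fst (@toC R) _ _ _ cvg_fst (@toC_continuous x)).
  exact: (@cvg_comp _ _ _ snd (@toC R) _ _ _ cvg_snd (@toC_continuous y)).
pose Q : set (R * R) := `[- s, s] `*` `[- s, s].
have Q_compact : compact (rect @` Q).
  apply: continuous_compact; first by apply: continuous_subspaceT => p; exact: rect_cont.
  by apply: compact_setX; exact: segment_compact.
apply: subclosed_compact (@closed_norm_le _ _) Q_compact _ => x /= xr.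
have [a aE] := real_toC (Creal_Re x); have [b bE] := real_toC (Creal_Im x).
have in_seg (y : R) : `|toC y| <= `|x| -> y \in `[- s, s].
  move=> yx; rewrite in_itv /= -ler_norml -toC_le -norm_toC -rE.
  exact: le_trans xr.
exists (a, b); last by rewrite /rect /= -aE -bE -Crect.
split; rewrite /=; apply: in_seg.
  by rewrite -aE; exact: (leif_normC_Re_Creal x).1.
(* The imaginary part is, up to sign, the real part of ['i * x], so the bound for real parts applies
   again. *)
rewrite -bE -normrN -ReMil.
by rewrite -[leRHS]mul1r -(normCi C) -normrM; exact: (leif_normC_Re_Creal _).1.
Qed.

End ComplexNumbers.

(** * Sections as sums of homogeneous parts, and the theorem *)

Section PartialSums.
Variables (R : realType) (n : nat).
Local Notation C := (Cplx R).

Lemma homogeneous_linear_section : homogeneous 1 (@linear_section R n).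
Proof. by apply: homogeneous_sum => j _; exact: homogeneous_coord. Qed.

Lemma homogeneous_monomial (beta : multi_index n) :
  homogeneous (\sum_(j < n) beta j)%N (@monomial R n beta).
Proof.
apply: (@homogeneous_prod C n _ _ (fun j => beta j)) => j.
by have := homogeneousX (beta j) (homogeneous_coord C j); rewrite muln1.
Qed.

Lemma homogeneous_homog_part (c : multi_index n -> C) (m : nat) :
  homogeneous m (homog_part c m).
Proof.
apply: homogeneous_sum => b /eqP bm.
rewrite -[m in homogeneous m]add0n; apply: homogeneousM; first exact: homogeneous_cst.
have := homogeneous_monomial [ffun j => nat_of_ord (b j)].
by under eq_bigr do rewrite ffunE; rewrite bm.
Qed.

Lemma derive_linear_section (y : 'rV[C]_n) (k : 'I_n) :
  'D_(delta_mx 0 k) (@linear_section R n) y = 1.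
Proof.
rewrite (@derive_along_poly C n _ _ _ ((linear_section y)%:P + 'X)).
  by rewrite derivD derivC derivX add0r hornerC.
move=> t; rewrite /linear_section hornerD hornerC hornerX.
under eq_bigr do rewrite !mxE.
rewrite big_split /= -mulr_sumr; congr (_ + _).
by rewrite (bigD1 k) //= eqxx big1 ?addr0 ?mulr1 // => j /negPf ->.
Qed.

End PartialSums.

Theorem theorem5p1 (R : realType) (n : nat) (hn : (1 <= n)%N)
    (alpha : R) (alpha_ge0 : 0 <= alpha) (alpha_lt1 : alpha < 1)
    (f h g : 'rV[Cplx R]_n -> Cplx R)
    (a b : multi_index n -> Cplx R)
    (f_class : class_P alpha f)
    (f_decomp : pluriharmonic_decomp f h g)
    (h_expansion : forall z, polydisc z ->
       linear_section z + higher_section a N z @[N --> \oo] --> h z)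
    (g_expansion : forall z, polydisc z ->
       higher_section b N z @[N --> \oo] --> g z)
    (q : nat) (hq : (2 <= q)%N) (z : 'rV[Cplx R]_n)
    (hz : `|z| < (2 * n%:R ^+ 2)^-1) :
  \sum_(k < n) 'Re (partial (@linear_section R n) k z - toC alpha)
    > \sum_(k < n) `|partial (higher_section b q) k z|.
Proof.
have [_ [h1 [g1 [[h1_hol g1_hol f1E] pos]]]] := f_class.
have [h_hol g_hol fE] := f_decomp.
have alpha_lt1C : toC alpha < 1 by rewrite -(rmorph1 (@toC R)) toC_lt.
exact: (@sum_derive_section_lt_linear (Cplx R) (@cvg_expr_Cplx R)
  (@compact_disc_Cplx R) n (homog_part b) (homog_part a) (@linear_section R n)
  f h g h1 g1 (toC alpha) q z hn (toC_real alpha) alpha_lt1C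
  (homogeneous_homog_part b) (homogeneous_homog_part a)
  (homogeneous_linear_section R n) (@derive_linear_section R n)
  h_hol g_hol fE h1_hol g1_hol f1E pos h_expansion g_expansion hz).
Qed.
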